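(* Let $N=1$, let $\alpha>0$ be a constant and $T>0$. Let $f$ be a non-negative, bounded and measurable function on $\mathbb{R}\times(0,T)$. Let $D_0=(s_0,\infty)$ with $s_0\in\mathbb{R}$ and let $u_0\equiv0$. Then there exists no solution $(u,S(t))$ on $(0,T)$ (in the sense defined in the context) to the free boundary problem $$\partial_t u-\Delta u=f \ \text{ in } Q_T,\qquad u=0 \ \text{ on } S_T,\qquad \partial u/\partial\nu=-\alpha \ \text{ on } S_T,$$ with initial data $u|_{t=0}=u_0$, $S(t)|_{t=0}=S_0=\partial D_0$.
   Context: Notation. $D(t)\subset\mathbb{R}^N$ $(0<t<T)$ are domains with boundary $S(t)=\partial D(t)$; $Q_T=\bigcup_{0<t<T}D(t)\times\{t\}$, $S_T=\bigcup_{0<t<T}S(t)\times\{t\}$; $\partial/\partial\nu$ is the exterior normal derivative of $D(t)$ on $S(t)$. Both $u$ and the free boundary $S(t)$ are unknown. Solution of the equations. A solution is a classical non-negative solution: $u=u(x,t)\ge0$ is $C^2$ in $x$ and $C^1$ in $t$ in $Q_T$, with $\nabla^2u,\partial_tu\in C(Q_T)$ and $u,\nabla u\in C(Q_T\cup S_T)$, satisfying the equation in $Q_T$ and the boundary conditions on $S_T$; moreover $S_T$ is uniformly $C^{2,1}$ ($C^2$ in space, $C^1$ in time) in $\mathbb{R}^N\times(\varepsilon,T)$ for every $\varepsilon>0$. Solution of the initial value problem. In addition, $u$ is bounded and is continuous up to $t=0$ on $\overline{D_0}$ with value $u_0$ there (i.e. $u$ extended by $u_0$ on $\overline{D_0}\times\{0\}$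 is continuous), and $S(t)\to S_0$ as $t\downarrow0$ in the uniform $C^2$ topology. No control of the time derivative of $S(t)$ up to $t=0$ is assumed. In the present one-dimensional situation with $D_0=(s_0,\infty)$, this means $D(t)=(s(t),\infty)$ with $s\in C([0,T))\cap C^1((0,T))$, $s(0)=s_0$ and $\dot s$ bounded on $(\varepsilon,T)$ for every $\varepsilon>0$ ($\dot s$ need not be integrable near $t=0$); the boundary conditions read $u(s(t),t)=0$ and $\partial_xu(s(t),t)=\alpha$ for $0<t<T$. *)

(* Defs.v *)
From HB Require Import structures.
From mathcomp Require Import all_boot all_order all_algebra.
From mathcomp Require Import all_classical all_reals all_analysis.
From mathcomp Require Import measurable_realfun.
Set Implicit Arguments.
Unset Strict Implicit.
Unset Printing Implicit Defensive.
Import Order.TTheory GRing.Theory Num.Theory.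
Import numFieldNormedType.Exports.
Local Open Scope classical_set_scope.
Local Open Scope ring_scope.

(* A point of space-time is a pair z = (x, t). *)

Section OneDimensionalProblem.
Variable R : realType.
Implicit Types (s : R -> R) (u f : R * R -> R) (z : R * R) (T : R).

Definition D s (t : R) : set R := `]s t, +oo[.

(* The boundary of D s t. *)
Definition S s (t : R) : set R := [set s t].

Definition QT s T : set (R * R) :=
  \bigcup_(t in `]0, T[) (D s t `*` [set t]).

Definition ST s T : set (R * R) :=
  \bigcup_(t in `]0, T[) (S s t `*` [set t]).

Definition derivable_x u z : Prop := derivable (fun x : R => u (x, z.2)) z.1 1.
Definition derivable_t u z : Prop := derivable (fun t : R => u (z.1, t)) z.2 1.
Definition dx u z : R := derive1 (fun x : R => u (x, z.2)) z.1.
Definition dt u z : R := derive1 (fun t : R => u (z.1, t)) z.2.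

(* The exterior unit normal of the half-line D s t at its left endpoint. *)
Definition nu : R := -1.

(* The exterior normal derivative of u at the boundary point z equals l; as u
   is only meaningful on the closure of the domain, the difference quotient is
   taken from inside, along z - h nu with h > 0. *)
Definition normal_derivative u z (l : R) : Prop :=
  (u z - u (z.1 - h * nu, z.2)) / h @[h --> 0^'+] --> l.

(* Measurability with respect to the Lebesgue (completed Borel) sigma-algebra
   of the plane, hence more general than Borel measurability. *)
Definition plane_measure := (@lebesgue_measure R \x @lebesgue_measure R)%E.

Definition lebesgue_measurable_fun (A : set (R * R)) f : Prop :=
  measurable_fun
    (A : set (g_sigma_algebraType (completed_algebra_gen plane_measure))) f.

(* The free boundary x = s(t), with initial position s0.  Nothing is assumed
   on the derivative of s near t = 0. *)
Record free_boundary (T s0 : R) s : Prop := FreeBoundary {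
  fb_cont : {within `[0, T[, continuous s} ;
  fb_init : s 0 = s0 ;
  fb_derivable : forall t : R, 0 < t < T -> derivable s t 1 ;
  fb_C1 : {within `]0, T[, continuous (derive1 s)} ;
  fb_bounded : forall e : R, 0 < e ->
    exists M : R, forall t : R, e < t < T -> `|derive1 s t| <= M }.

(* Classical non-negative solutions of
     dt u - dx (dx u) = f in QT,  u = 0 and d u / d nu = - alpha on ST,
   without initial condition. *)
Record equation_solution (alpha T : R) f u s : Prop := EquationSolution {
  sol_ge0 : forall z, (QT s T `|` ST s T) z -> 0 <= u z ;
  sol_derivable_x : forall z, QT s T z -> derivable_x u z ;
  sol_derivable_xx : forall z, QT s T z -> derivable_x (dx u) z ;
  sol_derivable_t : forall z, QT s T z -> derivable_t u z ;
  sol_cont_dxx : {within QT s T, continuous (dx (dx u))} ;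
  sol_cont_dt : {within QT s T, continuous (dt u)} ;
  sol_cont : {within QT s T `|` ST s T, continuous u} ;
  (* The gradient extends continuously to the lateral boundary. *)
  sol_cont_dx : exists2 g : R * R -> R,
    forall z, QT s T z -> g z = dx u z &
    {within QT s T `|` ST s T, continuous g} ;
  sol_eq : forall z, QT s T z -> dt u z - dx (dx u) z = f z ;
  sol_dirichlet : forall z, ST s T z -> u z = 0 ;
  sol_neumann : forall z, ST s T z -> normal_derivative u z (- alpha) }.

(* Solutions on (0, T) of the initial value problem with D_0 = (s0, +oo) and
   initial datum u0; u stands for the function already extended to t = 0 by
   u0 on the closure of D_0. *)
Record ivp_solution (alpha T s0 : R) (u0 : R -> R) f u s : Prop :=
  IvpSolution {
  ivp_free_boundary : free_boundary T s0 s ;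
  ivp_equation : equation_solution alpha T f u s ;
  ivp_bounded : exists M : R, forall z, QT s T z -> `|u z| <= M ;
  ivp_init : forall x, s0 <= x -> u (x, 0) = u0 x ;
  ivp_cont : {within QT s T `|` ST s T `|` (`[s0, +oo[ `*` [set 0]),
               continuous u} }.

End OneDimensionalProblem.

(* Main.v *)
Require Import Defs.
From mathcomp Require Import all_boot all_order all_algebra.
From mathcomp Require Import all_classical all_reals all_analysis.
From mathcomp Require Import ring lra.
Import Order.TTheory GRing.Theory Num.Theory.
Import numFieldNormedType.Exports.
Local Open Scope classical_set_scope.
Local Open Scope ring_scope.

(** Why no solution exists.  Bounded sources and zero initial data make u small,
    of order t, while the Neumann condition asks for the fixed slope alpha at the
    free boundary from the very first moment.  If the boundary did not move, a
    steep enough barrier would contradict this slope at once; the difficulty is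
    that s is merely continuous at t = 0, so the boundary may retreat at
    arbitrarily large speed, and a barrier attached to a retreating boundary has
    to be small.  The two effects balance as follows.

    - Comparison with a parabola around a point, growing linearly in time, gives
      u <= K t with K independent of the boundary (solution_le_linear).
    - Fix a small distance eta.  By continuity, s moves by less than eta up to a
      small time t1, so a line of speed c = eta / t1 overtakes s: the function
      s(t) - c t does not attain its minimum over [0, t1] at t = 0.  At a time
      t2 > 0 where it is attained, the line of speed c through (s(t2), t2) lies
      in the past to the left of the free boundary (overtaking_line).
    - Ahead of this line the travelling profile A (y - c y^2), y being the
      distance to the line, is a strict supersolution when A c exceeds sup f.  It
      is used up to its maximum, A / (4 c), at y = 1 / (2 c).  As soon as
      u <= A / (4 c) before t2, comparison bounds u by the profile, both vanish
      at (s(t2), t2), and so alpha <= A (slope_le_of_line).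

    Take A = alpha / 2.  Then A / (4 c) = alpha t1 / (8 eta), which is
    K t1 >= u for eta = alpha / (8 K).  Hence alpha <= alpha / 2, which is absurd.
    Everything rests on the maximum principle for strict subsolutions in a
    region bounded by two curves that are merely continuous
    (parabolic_max_principle). *)

Set Implicit Arguments.
Unset Strict Implicit.

(** * Derivative tests at a maximum *)

Lemma is_derive_quotient (R : realType) (g : R -> R) (c d : R) :
  is_derive c 1 g d -> (g (h + c) - g c) / h @[h --> 0^'] --> d.
Proof.
move=> gd.
have : cvg (h^-1 *: ((g \o shift c) (h *: (1:R)) - g c) @[h --> 0^']).
  exact: ex_derive.
rewrite -(@derive_val _ _ _ _ _ _ _ gd) /derive.
have -> : (fun h => h^-1 *: ((g \o shift c) (h *: (1:R)) - g c)) =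
          (fun h => (g (h + c) - g c) / h).
  by apply/funext => h; rewrite /= /GRing.scale /= mulr1 mulrC.
exact.
Qed.
(** The maximum is one-sided because a maximum over a space-time region may sit
    at its final time. *)
Lemma derive_ge0_at_left_max (R : realType) (g : R -> R) (a c d : R) :
  a < c -> is_derive c 1 g d -> (forall x, a < x < c -> g x <= g c) -> 0 <= d.
Proof.
move=> ac /is_derive_quotient gd gmax.
have gdl : (g (h + c) - g c) / h @[h --> 0^'-] --> d.
  apply: cvg_trans gd; apply: cvg_app.
  by apply: within_subset => x /=; exact: ltr0_neq0.
apply: (cvgr_to_ge gdl); near=> h.
have h0 : h < 0 by near: h; exact: nbhs_left_lt.
have hac : a - c < h by near: h; apply: nbhs_left_gt; lra.
rewrite -mulrNN; apply: mulr_ge0; last by rewrite -invrN invr_ge0; lra.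
by rewrite oppr_ge0 subr_le0; apply: gmax; lra.
Unshelve. all: by end_near. Qed.

(** A positive second derivative would make the first derivative, which vanishes
    at c, positive just after c; the mean value theorem then gives a larger value. *)
Lemma derive2_le0_at_max (R : realType) (g g1 : R -> R) (a b c d : R) :
  a < c < b ->
  (forall x, a < x < b -> is_derive x 1 g (g1 x)) -> is_derive c 1 g1 d ->
  (forall x, a < x < b -> g x <= g c) -> d <= 0.
Proof.
move=> /andP[ac cb] dg dg1 gmax; rewrite leNgt; apply/negP => d0.
have acb : c \in `]a, b[%R by rewrite in_itv /= ac cb.
have dg0 : is_derive c 1 g 0.
  have ab : a <= b by lra.
  apply: (@derive1_at_max _ _ a b) => // x.
  by rewrite in_itv /= => /dg xd; exact: ex_derive.
have g1c0 : g1 c = 0.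
  have dgc : is_derive c 1 g (g1 c) by apply: dg; rewrite ac.
  by rewrite -(@derive_val _ _ _ _ _ _ _ dgc) (@derive_val _ _ _ _ _ _ _ dg0).
have dg1r : (g1 (h + c) - g1 c) / h @[h --> 0^'+] --> d.
  move/is_derive_quotient : dg1; apply: cvg_trans.
  by apply: cvg_app; apply: within_subset => x /=; exact: lt0r_neq0.
have [e /= e0 he] := cvgr_gt _ dg1r 0 d0.
pose h := Num.min (e / 2) ((b - c) / 2).
have h0 : 0 < h by rewrite lt_min; apply/andP; split; lra.
have he2 : h <= e / 2 by rewrite ge_min lexx.
have hb2 : h <= (b - c) / 2 by rewrite ge_min lexx orbT.
have dch x : c <= x <= c + h -> is_derive x 1 g (g1 x).
  by move=> ?; apply: dg; lra.
have cch : c < c + h by lra.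
have [||y] := @MVT _ g g1 _ _ cch.
- by move=> x; rewrite in_itv /= => ?; apply: dch; lra.
- apply: derivable_within_continuous => x; rewrite in_itv /= => /dch xd.
  exact: ex_derive.
rewrite in_itv /= => /andP[cy ych] gy.
have yc0 : 0 < y - c by rewrite subr_gt0.
have g1y : 0 < g1 y.
  have : 0 < (g1 (y - c + c) - g1 c) / (y - c).
    by apply: he => //=; rewrite sub0r normrN gtr0_norm//; lra.
  by rewrite subrK g1c0 subr0 pmulr_lgt0 ?invr_gt0.
have : g (c + h) <= g c by apply: gmax; lra.
rewrite leNgt -subr_gt0 gy mulr_gt0//; lra.
Qed.

(** * The maximum principle between two curves *)

Definition strip (R : realType) (s r : R -> R) (tau : R) : set (R * R) :=
  [set z | 0 <= z.2 <= tau /\ s z.2 <= z.1 <= r z.2].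

(** The curves are continuous on [0, tau] only, so the strip is shown to be closed
    relatively to a closed box containing it. *)
Lemma strip_compact (R : realType) (s r : R -> R) (tau : R) :
  {within `[0, tau], continuous s} -> {within `[0, tau], continuous r} ->
  compact (strip s r tau).
Proof.
move=> cs cr.
have [tau0|tau0] := ltP tau 0.
  rewrite (_ : strip s r tau = set0); first exact: compact0.
  by apply/seteqP; split => // z [? _]; lra.
have [a _ sa] := EVT_min tau0 cs.
have [b _ rb] := EVT_max tau0 cr.
pose A : set (R * R) := `[s a, r b] `*` `[0, tau].
have cA : compact A by apply: compact_setX; exact: segment_compact.
have clA : closed A by apply: compact_closed => //; exact: norm_hausdorff.
have graph_cont (g : R -> R) : {within `[0, tau], continuous g} ->
    {within A, continuous (fun z : R * R => g z.2)}.
  move=> /subspace_continuousP cg; apply/subspace_continuousP => -[x t] [/= xab t0].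
  move=> B /(cg t t0) gB.
  have : nbhs (x, t) (snd @^-1` [set y | y \in `[0, tau] -> B (g y)]).
    by apply: cvg_snd.
  by apply: filterS => z /= gBz [_ zt]; exact: gBz.
have fst_cont : {within A, continuous (fun z : R * R => z.1)}.
  by apply: continuous_subspaceT => z; exact: cvg_fst.
have cl (g : R * R -> R) : {within A, continuous g} ->
    closed (A `&` [set z | 0 <= g z]).
  move=> cg; rewrite closed_setSI//.
  have pre : closed (g @^-1` [set x | 0 <= x] : set (subspace A)).
    apply: (@preimage_closed (subspace A) R g [set x | 0 <= x]) => [z _|].
      exact: cg.
    exact: closed_ge.
  exact: pre.
rewrite (_ : strip s r tau = (A `&` [set z | 0 <= z.1 - s z.2]) `&`
  (A `&` [set z | 0 <= r z.2 - z.1])).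
  apply: (@subclosed_compact _ _ A) => //; last by move=> z [[]].
  apply: closedI; apply: cl => z.
  - by apply: cvgB; [exact: fst_cont|exact: graph_cont].
  - by apply: cvgB; [exact: graph_cont|exact: fst_cont].
apply/seteqP; split => -[x t] /=.
  move=> [/= t0 /andP[sx xr]].
  have := rb t; rewrite in_itv/= => /(_ t0) rt.
  have := sa t; rewrite in_itv/= => /(_ t0) st.
  by rewrite /A/= !in_itv /=; split; split; [split| |split|]; lra.
move=> [[[_ +] sx] [_ xr]]; rewrite /= in_itv /= => t0.
by split => //=; lra.
Qed.

(** A maximum of w away from the initial time and the two curves has wxx <= 0 and
    wt >= 0, against wt < wxx.  Going back in time from it along a vertical line
    stays in the strip for a while by mere continuity of the curves. *)
Lemma parabolic_max_principle (R : realType) (s r : R -> R) (tau : R)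
    (w wx wxx wt : R * R -> R) :
  {within `[0, tau], continuous s} -> {within `[0, tau], continuous r} ->
  {within strip s r tau, continuous w} ->
  (forall x t, 0 < t <= tau -> s t < x < r t ->
    [/\ is_derive x 1 (fun y => w (y, t)) (wx (x, t)),
        is_derive x 1 (fun y => wx (y, t)) (wxx (x, t)),
        is_derive t 1 (fun t' => w (x, t')) (wt (x, t)) &
        wt (x, t) < wxx (x, t)]) ->
  (forall x t, strip s r tau (x, t) -> t = 0 \/ x = s t \/ x = r t ->
    w (x, t) <= 0) ->
  forall z, strip s r tau z -> w z <= 0.
Proof.
move=> cs cr cw dw bw z0 z0K.
have [[x t] /set_mem xtK wmax] :=
  compact_EVT_max (ex_intro _ z0 z0K) (strip_compact cs cr) cw.
apply: le_trans (wmax _ (mem_set z0K)) _.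
have {}wmax y t' : 0 <= t' <= tau -> s t' <= y <= r t' -> w (y, t') <= w (x, t).
  by move=> ? ?; apply: wmax; apply/mem_set; split.
have [t0|/eqP t0] := eqVneq t 0; first by apply: bw => //; left.
have [xs|/eqP xs] := eqVneq x (s t); first by apply: bw => //; right; left.
have [xr|/eqP xr] := eqVneq x (r t); first by apply: bw => //; right; right.
move: xtK => [/= /andP[t_ge0 t_le] /andP[sx rx]].
have t_gt0 : 0 < t by lra.
have {}sx : s t < x by lra.
have {}rx : x < r t by lra.
have [] := dw x t; [lra|lra|].
move=> _ dwxx dwt wtxx.
have wxx0 : wxx (x, t) <= 0.
  apply: (@derive2_le0_at_max _ (fun y => w (y, t)) (fun y => wx (y, t))
    (s t) (r t) x) => //.
  - by rewrite sx.
  - by move=> y sry; have [] := dw y t _ sry; first lra.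
  - by move=> y sry; apply: wmax; lra.
suff : 0 <= wt (x, t) by lra.
have leftnear (P : R -> Prop) :
    (\forall t' \near within `[0, tau] (nbhs t), P t') ->
    exists2 a, 0 <= a < t & forall t', a < t' < t -> P t'.
  move=> [e /= e0 eP]; exists (Num.max 0 (t - e)).
    by rewrite le_max lexx gt_max /=; lra.
  move=> t'; rewrite gt_max => /andP[/andP[t'0 t'e] t't].
  apply: eP; last by rewrite in_itv/=; lra.
  by rewrite /= gtr0_norm; lra.
have tI : `[0, tau]%classic t by rewrite /= in_itv/=; lra.
move/subspace_continuousP: cs => /(_ t tI).
move=> /cvgr_lt /(_ x sx) /leftnear[a at0 sa].
move/subspace_continuousP: cr => /(_ t tI).
move=> /cvgr_gt /(_ x rx) /leftnear[b bt0 rb].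
apply: (@derive_ge0_at_left_max _ (fun t' => w (x, t')) (Num.max a b) t) => //.
  by rewrite gt_max; lra.
move=> t'; rewrite gt_max => /andP[/andP[at' bt'] t't].
apply: wmax; first lra.
have st' : s t' < x by apply: sa; rewrite at'.
have rt' : x < r t' by apply: rb; rewrite bt'.
by rewrite !ltW.
Qed.

(** * Comparison of solutions with travelling parabolas *)

Lemma QT_in (R : realType) (s : R -> R) (T x t : R) :
  0 < t < T -> s t < x -> QT s T (x, t).
Proof.
move=> tT sx; exists t; first by rewrite /= in_itv.
by split => //; rewrite /D /= in_itv /= andbT.
Qed.

Lemma ST_in (R : realType) (s : R -> R) (T t : R) : 0 < t < T -> ST s T (s t, t).
Proof. by move=> tT; exists t => //=; rewrite in_itv. Qed.

Lemma free_boundary_cont_segment (R : realType) (T s0 tau : R) (s : R -> R) :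
  free_boundary T s0 s -> tau < T -> {within `[0, tau], continuous s}.
Proof.
move=> FB tauT; apply: continuous_subspaceW (fb_cont FB).
by move=> t /=; rewrite !in_itv/=; lra.
Qed.

Lemma strip_sub (R : realType) (T s0 tau : R) (s r : R -> R) :
  free_boundary T s0 s -> tau < T ->
  strip s r tau `<=` QT s T `|` ST s T `|` (`[s0, +oo[ `*` [set 0]).
Proof.
move=> FB tauT [x t] [/= t0 /andP[sx _]].
have [t00|/eqP t00] := eqVneq t 0.
  right; split => //=; rewrite in_itv/= andbT.
  by rewrite -(fb_init FB) -t00.
left; move: sx; rewrite le_eqVlt => /predU1P[<-|sx].
  by right; apply: ST_in; lra.
by left; apply: QT_in => //; lra.
Qed.

Lemma solution_is_derive (R : realType) (alpha T : R) (f u : R * R -> R)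
    (s : R -> R) (x t : R) :
  equation_solution alpha T f u s -> 0 < t < T -> s t < x ->
  [/\ is_derive x 1 (fun y => u (y, t)) (dx u (x, t)),
      is_derive x 1 (fun y => dx u (y, t)) (dx (dx u) (x, t)) &
      is_derive t 1 (fun t' => u (x, t')) (dt u (x, t))].
Proof.
move=> E tT sx; have xQ := QT_in tT sx.
by split; rewrite /dx /dt derive1E; apply: derivableP;
  [exact: sol_derivable_x E _ xQ|exact: sol_derivable_xx E _ xQ|
   exact: sol_derivable_t E _ xQ].
Qed.

(** One family serves for both barriers: with c = 0 a parabola at rest around e,
    with p = 0 a profile vanishing on the line x = e + c t. *)
Definition quadratic_wave (R : realType) (p a b e c : R) (z : R * R) : R :=
  p * z.2 + a * (z.1 - e - c * z.2) + b * (z.1 - e - c * z.2) ^+ 2.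

Lemma quadratic_wave_continuous (R : realType) (p a b e c : R) :
  continuous (quadratic_wave p a b e c).
Proof.
move=> z; rewrite /quadratic_wave.
have cy : (fun z : R * R => z.1 - e - c * z.2) z @[z --> z] --> z.1 - e - c * z.2.
  apply: cvgB; last by apply: cvgM; [exact: cvg_cst|exact: cvg_snd].
  by apply: cvgB; [exact: cvg_fst|exact: cvg_cst].
apply: cvgD; last by apply: cvgM; [exact: cvg_cst|apply: (cvgM cy cy)].
by apply: cvgD; apply: cvgM => //; try exact: cvg_cst; exact: cvg_snd.
Qed.

Lemma quadratic_wave_is_derive_x (R : realType) (p a b e c x t : R) :
  is_derive x 1 (fun y => quadratic_wave p a b e c (y, t))
    (a + 2 * b * (x - e - c * t)).
Proof.
rewrite /quadratic_wave /=; apply: is_derive_eq.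
by rewrite /GRing.scale/=; ring.
Qed.

Lemma quadratic_wave_is_derive_xx (R : realType) (a b e c x t : R) :
  is_derive x 1 (fun y => a + 2 * b * (y - e - c * t)) (2 * b).
Proof.
apply: is_derive_eq.
by rewrite /GRing.scale/=; ring.
Qed.

Lemma quadratic_wave_is_derive_t (R : realType) (p a b e c x t : R) :
  is_derive t 1 (fun t' => quadratic_wave p a b e c (x, t'))
    (p - c * (a + 2 * b * (x - e - c * t))).
Proof.
rewrite /quadratic_wave /=; apply: is_derive_eq.
by rewrite /GRing.scale/=; ring.
Qed.

(** Only the line x = e + c t + rho needs a comparison of u with the barrier; at the
    initial time and on the free boundary u vanishes, so that a nonnegative barrier
    is enough there. *)
Lemma quadratic_wave_comparison (R : realType) (alpha T s0 : R) (f u : R * R -> R)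
    (s : R -> R) (tau rho p a b e c M : R) :
  ivp_solution alpha T s0 (fun=> 0) f u s ->
  tau < T -> (forall z : R * R, (setT `*` `]0, T[) z -> `|f z| <= M) ->
  (forall x t : R, 0 < t <= tau -> s t < x < e + c * t + rho ->
     M < p - c * (a + 2 * b * (x - e - c * t)) - 2 * b) ->
  (forall x t : R, 0 <= t <= tau -> s t <= x <= e + c * t + rho ->
     0 <= quadratic_wave p a b e c (x, t)) ->
  (forall x t : R, 0 < t <= tau -> s t < x -> x = e + c * t + rho ->
     u (x, t) <= quadratic_wave p a b e c (x, t)) ->
  forall x t : R, 0 <= t <= tau -> s t <= x <= e + c * t + rho ->
    u (x, t) <= quadratic_wave p a b e c (x, t).
Proof.
move=> usol tauT fM supersol wave_ge0 lateral x t t0 sxr.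
have E := ivp_equation usol; have FB := ivp_free_boundary usol.
rewrite -subr_le0.
pose r t' := e + c * t' + rho.
pose v := quadratic_wave p a b e c.
apply: (@parabolic_max_principle _ s r tau (fun z => u z - v z)
  (fun z => dx u z - (a + 2 * b * (z.1 - e - c * z.2)))
  (fun z => dx (dx u) z - 2 * b)
  (fun z => dt u z - (p - c * (a + 2 * b * (z.1 - e - c * z.2)))) _ _ _ _ _ (x, t)).
- exact: free_boundary_cont_segment FB tauT.
- apply: continuous_subspaceT => y; apply: cvgD; last exact: cvg_cst.
  by apply: cvgD; [exact: cvg_cst|apply: cvgM; [exact: cvg_cst|exact: cvg_id]].
- move=> z; apply: cvgB.
    apply: (continuous_subspaceW (@strip_sub _ _ _ _ _ _ FB tauT)).
    exact: ivp_cont usol.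
  by apply: continuous_subspaceT; exact: quadratic_wave_continuous.
- move=> y t' t'0 sy; have t'T : 0 < t' < T by lra.
  have /andP[sy' _] := sy.
  have [du ddu dtu] := solution_is_derive E t'T sy'.
  split.
  + apply: is_deriveB; exact: quadratic_wave_is_derive_x.
  + apply: is_deriveB; exact: quadratic_wave_is_derive_xx.
  + apply: is_deriveB; exact: quadratic_wave_is_derive_t.
  + have := sol_eq E (QT_in t'T sy').
    have := fM (y, t'); rewrite /= in_itv /= => /(_ (conj I t'T)).
    rewrite ler_norml => /andP[_ ?] ?.
    by have := supersol _ _ t'0 sy; rewrite /=; lra.
- move=> y t' [/= t'0 sy] bdry; rewrite subr_le0.
  have u0 : u (y, t') = 0 -> u (y, t') <= v (y, t') by move->; exact: wave_ge0.
  have [t'00|/eqP t'00] := eqVneq t' 0.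
    apply: u0; rewrite t'00 (ivp_init usol)//.
    by rewrite -(fb_init FB) -t'00; lra.
  have [ys|/eqP ys] := eqVneq y (s t').
    by apply: u0; rewrite ys; apply: (sol_dirichlet E); apply: ST_in; lra.
  case: bdry => [//|[//|yr]].
  by apply: lateral => //; lra.
- by [].
Qed.

(** The barrier around x is (M + 2 N + 1) t + N (y - x)^2 for y <= x + 1: its
    quadratic part dominates u at y = x + 1, and its growth in time beats both the
    source and the diffusion 2 N of the quadratic part. *)
Lemma solution_le_linear (R : realType) (alpha T s0 : R) (f u : R * R -> R)
    (s : R -> R) (M N : R) :
  ivp_solution alpha T s0 (fun=> 0) f u s ->
  (forall z : R * R, (setT `*` `]0, T[) z -> `|f z| <= M) ->
  (forall z, QT s T z -> `|u z| <= N) -> 0 <= M -> 0 <= N ->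
  forall x t : R, 0 < t < T -> s t < x -> u (x, t) <= (M + 2 * N + 1) * t.
Proof.
move=> usol fM uN M0 N0 x t tT sx.
have wave_x0 :
    quadratic_wave (M + 2 * N + 1) 0 N x 0 (x, t) = (M + 2 * N + 1) * t.
  by rewrite /quadratic_wave /=; ring.
have K0 : 0 <= M + 2 * N + 1 by lra.
rewrite -wave_x0; apply: (quadratic_wave_comparison usol
  (tau := t) (rho := 1) (M := M)) => //; try lra.
- move=> y t' _ _; lra.
- move=> y t' t'0 _; rewrite /quadratic_wave /= mul0r addr0.
  by apply: addr_ge0; apply: mulr_ge0 => //; [lra | exact: sqr_ge0].
- move=> y t' t'0 sy yE.
  have t'T : 0 < t' < T by lra.
  have := uN (y, t') (QT_in t'T sy); rewrite ler_norml => /andP[_ uyN].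
  rewrite (le_trans uyN)// /quadratic_wave /= {1}yE !mul0r !addr0 subr0.
  rewrite (_ : y - x = 1); last by lra.
  by rewrite expr1n mulr1 lerDr mulr_ge0//; lra.
Qed.

(** * The slope at the free boundary *)

(** The line x = e + c t touches the free boundary at time t2 and stays behind it
    before; u is then below the profile A y (1 - c y), where y = x - e - c t is at
    most 1 / (2 c), and the profile has slope A at the contact point. *)
Lemma slope_le_of_line (R : realType) (alpha T s0 : R) (f u : R * R -> R)
    (s : R -> R) (A M c e t2 : R) :
  ivp_solution alpha T s0 (fun=> 0) f u s ->
  (forall z : R * R, (setT `*` `]0, T[) z -> `|f z| <= M) ->
  0 < A -> 0 < c -> M < A * c -> 0 < t2 < T ->
  e + c * t2 = s t2 -> (forall t, 0 <= t <= t2 -> e + c * t <= s t) ->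
  (forall x t : R, 0 < t <= t2 -> s t < x -> u (x, t) <= A / (4 * c)) ->
  alpha <= A.
Proof.
move=> usol fM A0 c0 AcM t2T et2 line_le u_le.
have E := ivp_equation usol.
have u_le_wave x :
    s t2 <= x <= s t2 + (2 * c)^-1 -> u (x, t2) <= A * (x - s t2).
  move=> sx.
  have waveE y t : quadratic_wave 0 A (- (A * c)) e c (y, t) =
      A * (y - (e + c * t)) * (1 - c * (y - (e + c * t))).
    by rewrite /quadratic_wave /=; ring.
  have rhoE : c * (2 * c)^-1 = 2^-1.
    by rewrite invfM mulrCA mulfV ?mulr1//; lra.
  have : u (x, t2) <= quadratic_wave 0 A (- (A * c)) e c (x, t2).
    apply: (quadratic_wave_comparison usol
      (tau := t2) (rho := (2 * c)^-1) (M := M)) => //.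
    - lra.
    - move=> y t tt2 /andP[sy _].
      have /line_le ly : 0 <= t <= t2 by lra.
      have {}ly : 0 < y - e - c * t by lra.
      have : 0 < A * c * c * (y - e - c * t) by do ![apply: mulr_gt0 => //].
      lra.
    - move=> y t tt2 /andP[sy yr]; rewrite waveE.
      have ly := line_le t tt2.
      apply: mulr_ge0; first by apply: mulr_ge0; lra.
      have : c * (y - (e + c * t)) <= c * (2 * c)^-1 by rewrite ler_pM2l//; lra.
      by rewrite rhoE; lra.
    - move=> y t tt2 sy yr; rewrite waveE.
      have -> : y - (e + c * t) = (2 * c)^-1 by rewrite yr; lra.
      rewrite rhoE; apply: (le_trans (u_le _ _ tt2 sy)).
      by rewrite !invfM; lra.
    - lra.
    - by rewrite et2.
  rewrite waveE et2 => /le_trans; apply.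
  have : 0 <= A * c * (x - s t2) ^+ 2.
    by rewrite mulr_ge0 ?sqr_ge0// ltW// mulr_gt0.
  lra.
suff : - A <= - alpha by lra.
have := sol_neumann E (ST_in s t2T); rewrite /normal_derivative => nd.
apply: (cvgr_to_ge nd); near=> h.
have h0 : 0 < h by near: h; exact: nbhs_right_gt.
have hc : h <= (2 * c)^-1.
  by near: h; apply: nbhs_right_le; rewrite invr_gt0; lra.
rewrite ler_pdivlMr// (sol_dirichlet E (ST_in s t2T)) /nu /=.
have := u_le_wave (s t2 + h); rewrite mulrN1 opprK => /(_ _); lra.
Unshelve. all: by end_near. Qed.

(** The line of speed c from (s 0, 0) has passed the curve at time t1.  Pushed to
    the left until it no longer crosses the curve, it touches it at a time where
    s t - c t is minimal, and this time is not 0. *)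
Lemma overtaking_line (R : realType) (s : R -> R) (t1 c : R) :
  0 < t1 -> {within `[0, t1], continuous s} -> s t1 < s 0 + c * t1 ->
  exists2 t2, 0 < t2 <= t1 &
    forall t, 0 <= t <= t1 -> s t2 - c * t2 + c * t <= s t.
Proof.
move=> t10 cs st1.
have s_ct : {within `[0, t1], continuous (fun t => s t - c * t)}.
  move=> t; apply: cvgB; first exact: cs.
  apply: continuous_subspaceT => {}t.
  by apply: cvgM; [exact: cvg_cst | exact: cvg_id].
have [t2] := EVT_min (ltW t10) s_ct.
rewrite in_itv/= => /andP[t2_ge0 t2_le] s_min.
have {}s_min t : 0 <= t <= t1 -> s t2 - c * t2 <= s t - c * t.
  by move=> ?; apply: s_min; rewrite in_itv.
exists t2; last by move=> t /s_min; lra.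
rewrite t2_le lt_neqAle t2_ge0 !andbT; apply/eqP => t2E.
have := s_min t1; rewrite -t2E => /(_ _); lra.
Qed.

Lemma free_boundary_close_at_small_time (R : realType) (T s0 eta d : R)
    (s : R -> R) :
  0 < T -> free_boundary T s0 s -> 0 < eta -> 0 < d ->
  exists2 t, 0 < t < T & t < d /\ s t < s0 + eta.
Proof.
move=> T0 FB eta0 d0.
have I0 : `[0, T[%classic (0 : R) by rewrite /= in_itv/= lexx.
have s_lt : s 0 < s0 + eta by rewrite (fb_init FB); lra.
have /subspace_continuousP/(_ _ I0)/cvgr_lt/(_ _ s_lt)[r /= r0 rs] := fb_cont FB.
pose t := Num.min (Num.min (r / 2) (T / 2)) (d / 2).
have tr : t <= r / 2 by rewrite !ge_min lexx.
have tT : t <= T / 2 by rewrite !ge_min lexx orbT.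
have td : t <= d / 2 by rewrite !ge_min lexx !orbT.
have t0 : 0 < t by rewrite !lt_min; apply/andP; split; lra.
exists t; first by lra.
split; first by lra.
apply: rs; last by rewrite in_itv/=; lra.
by rewrite /= sub0r normrN gtr0_norm//; lra.
Qed.

Unset Implicit Arguments.

Theorem theorem1p1 (R : realType) (alpha T s0 : R) (f : R * R -> R)
    (alpha_gt0 : 0 < alpha) (T_gt0 : 0 < T)
    (f_ge0 : forall z : R * R, (setT `*` `]0, T[) z -> 0 <= f z)
    (f_bounded : exists M : R,
       forall z : R * R, (setT `*` `]0, T[) z -> `|f z| <= M)
    (f_meas : lebesgue_measurable_fun (setT `*` `]0, T[) f) :
  ~ exists (u : R * R -> R) (s : R -> R),
      ivp_solution alpha T s0 (fun=> 0) f u s.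
Proof.
move=> [u [s usol]].
have FB := ivp_free_boundary usol.
have [M fM] := f_bounded; have [N uN] := ivp_bounded usol.
have T2 : 0 < T / 2 < T by lra.
have M0 : 0 <= M.
  by apply: le_trans (fM (0, T / 2) _) => //; split => //=; rewrite in_itv.
have N0 : 0 <= N.
  apply: le_trans (normr_ge0 _) (uN (s (T / 2) + 1, T / 2) _).
  by apply: QT_in => //; lra.
pose K := M + 2 * N + 1.
have K_ge1 : 1 <= K by rewrite /K; lra.
pose eta := alpha / (8 * K).
have etaK : eta * (8 * K) = alpha by rewrite /eta mulfVK//; lra.
have eta0 : 0 < eta by rewrite divr_gt0//; lra.
(* The bound on t1 makes the speed eta / t1 exceed 2 M / alpha. *)
have d0 : 0 < eta * alpha / (2 * M + 1).
  by apply: divr_gt0; [exact: mulr_gt0 | lra].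
have [t1 t1T [t1d st1]] := free_boundary_close_at_small_time T_gt0 FB eta0 d0.
have t10 : 0 < t1 by lra.
pose c := eta / t1.
have c0 : 0 < c by rewrite divr_gt0.
have ct1 : c * t1 = eta by rewrite /c mulfVK//; lra.
have cM : M < alpha / 2 * c.
  rewrite /c mulrA ltr_pdivlMr//.
  by move: t1d; rewrite ltr_pdivlMr; lra.
have cs : {within `[0, t1], continuous s}.
  by apply: free_boundary_cont_segment FB _; lra.
have st1c : s t1 < s 0 + c * t1 by rewrite ct1 (fb_init FB).
have [t2 t2t1 line_le] := overtaking_line t10 cs st1c.
suff : alpha <= alpha / 2 by lra.
apply: (slope_le_of_line usol fM _ c0 cM (t2 := t2) (e := s t2 - c * t2)).
- lra.
- lra.
- by rewrite subrK.
- by move=> t t0; apply: line_le; lra.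
- move=> x t tt2 sx; have tT : 0 < t < T by lra.
  apply: (le_trans (solution_le_linear usol fM uN M0 N0 tT sx)).
  have topE : alpha / 2 / (4 * c) = K * t1.
    rewrite -etaK -ct1; field; lra.
  by rewrite topE ler_pM2l; lra.
Qed.
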